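(* Let $K$ be a field, let $k,\ell,d$ be integers with $2\le k\le \ell\le d$, and let $I_0$, $I_S$, $\mathcal{L}$, $G(I_0)$ and the term order $\prec_{\mathrm{lex}}$ be as defined in the context. 1. The set $G(I_0)$ forms a Gröbner basis for $I_0$ with respect to $\prec_{\mathrm{lex}}$. 2. For any $S\in\mathcal{L}$, the generators of $I_S$ (the variables $p_{i,j}$ with $i\in[d]$, $j\in S$, together with the $2$-minors $[A|B]$ with $A\subseteq[d]$, $B\subseteq C_j$ for some $j\in[\ell]$, $|A|=|B|=2$) form a Gröbner basis of $I_S$ with respect to $\prec_{\mathrm{lex}}$.
   Context: Let $K$ be a field and $2\le k\le\ell\le d$ integers. Let $P=(p_{x,y})_{x\in[d],\,y\in[k\ell]}$ be a $d\times k\ell$ matrix of indeterminates and $R=K[P]$. For $A\subseteq[d]$, $B\subseteq[k\ell]$ with $|A|=|B|$, $[A|B]$ denotes the determinant of the submatrix of $P$ with rows indexed by $A$ and columns indexed by $B$ (in increasing order). Arrange $[k\ell]$ in a $k\times\ell$ matrix $\mathcal{Y}$ with entries $\mathcal{Y}_{i,j}=(j-1)k+i$ for $i\in[k]$, $j\in[\ell]$. Put $R_i=\{\mathcal{Y}_{i,j}: j\in[\ell]\}$ for $i\in[k]$ and $C_j=\{\mathcal{Y}_{i,j}: i\in[k]\}$ for $j\in[\ell]$. Let $\Delta=\bigcup_{j\in[\ell]}\{B\subseteq C_j: |B|=2\}\cup\{R_1,\dots,R_k\}$. Ideals of $R$: - $I_0=\langle [A|B] : A\subseteq[d],\ B\subseteq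 C_j \text{ for some } j\in[\ell],\ |A|=|B|=2\rangle+\langle [A|B]: A\subseteq[d],\ B\subseteq[k\ell],\ |A|=|B|=\ell\rangle$. - For $S\subseteq[k\ell]$: $I_S=\langle p_{i,j}: i\in[d],\ j\in S\rangle+\langle [A|B] : A\subseteq[d],\ B\subseteq C_j \text{ for some } j\in[\ell],\ |A|=|B|=2\rangle$. $\mathcal{L}=\big\{\{\mathcal{Y}_{i_1,j_1},\dots,\mathcal{Y}_{i_k,j_k}\} : |\{i_1,\dots,i_k\}|=k,\ |\{j_1,\dots,j_k\}|\ge 2\big\}$. $G(I_0)=\{[A|B]: A\subseteq[d],\ B\in\Delta,\ |A|=|B|=2\}\ \cup\ \{[A|B]: A\subseteq[d],\ B\subseteq[k\ell],\ |A|=|B|=\ell,\ |B\cap C_j|\le 1\text{ for each } j\in[\ell]\}$. $\prec_{\mathrm{lex}}$ is the lexicographic term order on $R$ induced by the order of variables $p_{u,i}>p_{v,m}$ if and only if $u<v$, or $u=v$ and $i<m$. *)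

(* Defs.v *)
From HB Require Import structures.
From mathcomp Require Import all_boot all_order all_algebra.
From mathcomp Require Import mpoly.

Set Implicit Arguments.
Unset Strict Implicit.
Unset Printing Implicit Defensive.

Import GRing.Theory.
Local Open Scope ring_scope.

                                                                       

Definition ideal_gen (R : comNzRingType) (G : R -> Prop) (f : R) : Prop :=
  exists s : seq (R * R),
    (forall c, c \in s -> G c.2) /\ f = \sum_(c <- s) c.1 * c.2.

Definition ideal_add (R : comNzRingType) (I J : R -> Prop) (f : R) : Prop :=
  exists g h : R, [/\ I g, J h & f = g + h].

                                                                            
               
Definition initial_monomial (K : fieldType) (n : nat) (lt : rel 'X_{1..n})
    (f : {mpoly K[n]}) (m : 'X_{1..n}) : Prop :=
  m \in msupp f /\ (forall m', m' \in msupp f -> m' != m -> lt m' m).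

Definition initial_ideal (K : fieldType) (n : nat) (lt : rel 'X_{1..n})
    (F : {mpoly K[n]} -> Prop) : {mpoly K[n]} -> Prop :=
  ideal_gen (fun g => exists f m,
    [/\ F f, initial_monomial lt f m & g = 'X_[m]]).

Definition groebner_basis (K : fieldType) (n : nat) (lt : rel 'X_{1..n})
    (G I : {mpoly K[n]} -> Prop) : Prop :=
  [/\ exists s : seq {mpoly K[n]}, forall g, G g <-> g \in s,
      forall g, G g -> I g &
      forall f, initial_ideal lt G f <-> initial_ideal lt I f].

Definition generic_mx (K : fieldType) (d e : nat) :
    'M[{mpoly K[d * e]}]_(d, e) :=
  \matrix_(x, y) 'X_(mxvec_index x y).

                                                                             
Definition minor (R : comNzRingType) (d e : nat) (M : 'M[R]_(d, e))
    (A : {set 'I_d}) (B : {set 'I_e}) (eqAB : #|A| = #|B|) : R :=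
  \det (mxsub (fun i : 'I_#|A| => enum_val i)
              (fun j : 'I_#|A| => enum_val (cast_ord eqAB j)) M).

Definition generic_minors (K : fieldType) (d e r : nat) (Bs : pred {set 'I_e})
    (f : {mpoly K[d * e]}) : Prop :=
  exists (A : {set 'I_d}) (B : {set 'I_e}) (eqAB : #|A| = #|B|),
    [/\ #|A| = r, Bs B & f = minor (generic_mx K d e) eqAB].

Definition var_gt (d e : nat) (u : 'I_d) (i : 'I_e) (v : 'I_d) (m : 'I_e) :
    bool :=
  ((u < v) || ((u == v) && (i < m)))%N.

                                                                       
                                
Definition lex_lt (d e : nat) : rel 'X_{1..d * e} := fun m1 m2 =>
  [exists x : 'I_d, exists y : 'I_e,
    (m1 (mxvec_index x y) < m2 (mxvec_index x y))%N
    && [forall u : 'I_d, forall i : 'I_e,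
         var_gt u i x y ==>
         (m1 (mxvec_index u i) == m2 (mxvec_index u i))]].

Lemma Yij_subproof (k l : nat) (i : 'I_k) (j : 'I_l) : (j * k + i < k * l)%N.
Proof.
apply: (@leq_trans (j.+1 * k)); last by rewrite mulnC leq_mul2l ltn_ord orbT.
by rewrite mulSn addnC ltn_add2r.
Qed.

Definition Yij (k l : nat) (i : 'I_k) (j : 'I_l) : 'I_(k * l) :=
  Ordinal (Yij_subproof i j).

Definition rowY (k l : nat) (i : 'I_k) : {set 'I_(k * l)} :=
  [set Yij i j | j : 'I_l].

Definition colY (k l : nat) (j : 'I_l) : {set 'I_(k * l)} :=
  [set Yij i j | i : 'I_k].

Definition Delta (k l : nat) : {set {set 'I_(k * l)}} :=
  (\bigcup_(j < l) [set B : {set 'I_(k * l)} | (B \subset colY k j)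
                                               & (#|B| == 2)%N])
  :|: [set rowY l i | i : 'I_k].

Definition calL (k l : nat) (S : {set 'I_(k * l)}) : Prop :=
  exists (i : 'I_k -> 'I_k) (j : 'I_k -> 'I_l),
    [/\ #|[set i t | t : 'I_k]| = k,
        (2 <= #|[set j t | t : 'I_k]|)%N &
        S = [set Yij (i t) (j t) | t : 'I_k]].

Definition column_minors (K : fieldType) (d k l : nat) :
    {mpoly K[d * (k * l)]} -> Prop :=
  generic_minors 2 (fun B => [exists j : 'I_l, B \subset colY k j]).

Definition I_0 (K : fieldType) (d k l : nat) : {mpoly K[d * (k * l)]} -> Prop :=
  ideal_add (ideal_gen (@column_minors K d k l))
            (ideal_gen (generic_minors l predT)).

Definition gens_I_S (K : fieldType) (d k l : nat) (S : {set 'I_(k * l)})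
    (f : {mpoly K[d * (k * l)]}) : Prop :=
  (exists (i : 'I_d) (j : 'I_(k * l)), j \in S /\ f = generic_mx K d (k * l) i j)
  \/ column_minors f.

Definition I_S (K : fieldType) (d k l : nat) (S : {set 'I_(k * l)}) :
    {mpoly K[d * (k * l)]} -> Prop :=
  ideal_gen (gens_I_S S).

Definition G_I_0 (K : fieldType) (d k l : nat) (f : {mpoly K[d * (k * l)]}) :
    Prop :=
  generic_minors 2 (fun B => B \in Delta k l) f
  \/ generic_minors l
       (fun B => [forall j : 'I_l, (#|B :&: colY k j| <= 1)%N]) f.

(* Main.v *)
From HB Require Import structures.
Require Import Defs.
From mathcomp Require Import all_boot all_order all_algebra.
From mathcomp Require Import fingroup perm mpoly.

Set Implicit Arguments.
Unset Strict Implicit.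
Unset Printing Implicit Defensive.

Import GRing.Theory.

(** It is enough to divide leading monomials: the leading monomial [m] of a
    nonzero element [f] of the ideal must be a multiple of the leading monomial
    of some generator ([groebner_basis_criterion]).  A minor leads with its main
    diagonal ([det_initial_monomial]).  So let [m] be divisible by the main
    diagonal of no 2-minor inside a block [C_j] (it is [block_standard]); the
    remaining generators have to be found in [m], and this is done by evaluating
    [f] at a generic point of the variety of the ideal, chosen according to [m].

    The point is p_(x,y) = b_y L_(x,j), for y in C_j.  Inside a block it has
    rank one, so all 2-minors of blocks vanish.  For [I_S], put b_y = 0 for y in
    S and let the L_(x,j) be independent variables a_(x,j).  For [I_0], the
    variables a_(x,j) are independent up to one relation per row: the row sums
    of L are zero, where in row x the entry of column e(x) is expressed through
    the others.  Then L has rank less than l, and all l-minors vanish.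

    Write r(x,j) for the degree of [m] in the variables of row x and block C_j.
    Every monomial of the image of a monomial [m'] determines the degree of [m']
    in each column y, through the b_y.  Among monomials with given column
    degrees a block-standard one is as small as its matrix r permits: if
    m' < m then r' < r lexicographically ([block_sum_lex]).  This reduces the
    problem from the k l columns y to the l columns j.

    The function e is a staircase walk through r: start in the leftmost column,
    go down, and step to the right after each row in which the current entry of
    r is positive.  If the walk reaches column l, the rows after which it
    stepped give a chain x_1 < ... < x_l with r(x_j,j) > 0, that is, the main
    diagonal of an l-minor with one column in each block, dividing [m].
    Otherwise, let nu be the monomial of the image of [m] in which each
    eliminated a_(x,e(x)) contributes a_(x,e(x)+1).  It occurs with a nonzero
    coefficient, being the only monomial of maximal weight for a suitable weight
    ([dominant_mmap1]), while it occurs in the image of no m' < m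
    ([param_kernel_lex], [stair_lex]).  Hence the image of [f] is not zero, a
    contradiction.  For [I_S] the contradiction is reached without a walk, as
    nu then determines the matrix r completely. *)

(** * Staircase walks in a matrix of multiplicities *)

Lemma sum_eq_lt_le_false (I : finType) (F G : I -> nat) (i : I) :
  \sum_j F j = \sum_j G j -> (forall j, F j <= G j) -> ~ F i < G i.
Proof.
move=> eqs le lti; suff: \sum_j F j < \sum_j G j by rewrite eqs ltnn.
rewrite (bigD1 i) // [X in _ < X](bigD1 i) //= -addSn leq_add //.
exact: leq_sum.
Qed.

Lemma sum_eq_le (I : finType) (F G : I -> nat) :
  \sum_j F j = \sum_j G j -> (forall j, F j <= G j) -> F =1 G.
Proof.
move=> eqs le i; apply/eqP; rewrite eqn_leq le leqNgt /=.
by apply/negP; apply: sum_eq_lt_le_false eqs le.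
Qed.

Section Staircase.
Variables (d l : nat) (r : 'I_d -> 'I_l -> nat).

(** The column of the walk before row [n].  Its values are natural numbers, so
    that the walk can leave the matrix through column [l]: there no entry is
    found and it stops moving. *)
Fixpoint stair (n : nat) : nat :=
  if n is n'.+1 then
    stair n' + [exists x : 'I_d, exists j : 'I_l,
                  [&& x == n' :> nat, j == stair n' :> nat & 0 < r x j]]
  else 0.

Lemma leq_stair : {homo stair : m n / m <= n}.
Proof. by apply: homo_leq leq_trans _ => // n; rewrite leq_addr. Qed.

Lemma stairS (x : 'I_d) (j : 'I_l) :
  stair x = j -> stair x.+1 = stair x + (0 < r x j).
Proof.
move=> ej /=; congr (_ + nat_of_bool _); apply/existsP/idP.
  move=> [x' /existsP[j' /and3P[/eqP/val_inj-> /eqP]]].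
  by rewrite ej => /val_inj->.
by move=> pos; exists x; apply/existsP; exists j; rewrite ej !eqxx.
Qed.

(** The walk moves by single steps, so it leaves every column that it has
    passed, and it leaves a column only at a positive entry. *)
Lemma stair_onto n j : j < stair n ->
  exists (x : 'I_d) (i : 'I_l), [/\ stair x = j, i = j :> nat & 0 < r x i].
Proof.
elim: n => [//|n IHn] /=; case: existsP => [[x /existsP[i /and3P[]]]|_]; last first.
  by rewrite addn0.
move=> /eqP xn /eqP ij pos; rewrite addn1 ltnS leq_eqVlt => /orP[/eqP jE|//].
  by exists x, i; rewrite xn jE.
Qed.

Lemma stair_lt (x x' : nat) : stair x < stair x' -> x < x'.
Proof. by apply: contraTT; rewrite -!leqNgt; apply: leq_stair. Qed.

(** If [r] and [r'] have the same row and column sums, and [r'] is at most [r]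
    except along the walk and one column to its right, then [r'] cannot be
    lexicographically smaller than [r].  Below the row in which the walk
    leaves a column, that column is subject to [r' <= r]; while [r] and [r']
    agree above, equal column sums force equality in the whole column.  So at
    the first difference, in row [u], all columns left of the walk agree. *)
Lemma stair_lex (r' : 'I_d -> 'I_l -> nat) (u : 'I_d) (v : 'I_l) :
  stair d < l ->
  (forall x, \sum_j r' x j = \sum_j r x j) ->
  (forall j, \sum_x r' x j = \sum_x r x j) ->
  (forall (x : 'I_d) (j : 'I_l),
     j != stair x :> nat -> j != (stair x).+1 :> nat -> r' x j <= r x j) ->
  (forall (x : 'I_d) (j : 'I_l), x < u -> r' x j = r x j) ->
  (forall j : 'I_l, j < v -> r' u j = r u j) ->
  ~ r' u v < r u v.
Proof.
move=> small rows cols le_r eq_up eq_left lt_uv.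
have bnd (n : nat) : n <= d -> stair n < l.
  by move=> /leq_stair le; apply: leq_ltn_trans le small.
have below (x : 'I_d) (j : 'I_l) : j < stair x -> r' x j <= r x j.
  by move=> lt_j; apply: le_r; rewrite ltn_eqF // ltnW.
(* The columns already left by the walk agree, by induction on the row. *)
have eq_col n : n <= u -> forall (j : 'I_l) (x : 'I_d), j < stair n -> r' x j = r x j.
  elim: n => [//|n IHn] lt_nu j x.
  have lt_nd : n < d by apply: ltn_trans (ltn_ord u).
  pose c := Ordinal (bnd n (ltnW lt_nd)).
  have := stairS (x := Ordinal lt_nd) (j := c) erefl => /= ->.
  have [rp|_] := ltnP 0 (r _ c); last by rewrite addn0; apply: IHn (ltnW lt_nu) _ _.
  rewrite addn1 ltnS leq_eqVlt => /orP[/eqP jc|]; last exact: IHn (ltnW lt_nu) _ _.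
  have {jc} -> : j = c by apply: val_inj.
  apply: (sum_eq_le (cols c)) => y; have [le_yn|lt_ny] := leqP y n.
    by rewrite eq_up //; apply: leq_ltn_trans le_yn _.
  apply: below; have := stairS (x := Ordinal lt_nd) (j := c) erefl.
  rewrite rp addn1 /= => e; apply: leq_trans (leq_stair lt_ny).
  by rewrite /= e.
pose c := Ordinal (bnd u (ltnW (ltn_ord u))).
have [lt_vc|le_cv] := ltnP v c; first by rewrite (eq_col u (leqnn u)) ?ltnn in lt_uv.
have [vc|lt_cv] := eqVneq v c.
  (* The walk leaves [c] in row [u], as [r u c] is positive: compare the sums
     of column [c]. *)
  have rp : 0 < r u c by rewrite -vc; apply: leq_ltn_trans lt_uv.
  rewrite vc in lt_uv; apply: (sum_eq_lt_le_false (cols c) _ lt_uv) => x.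
  have [lt_xu|lt_ux|/val_inj->] := ltngtP x u; last 1 first.
  - exact: ltnW.
  - by rewrite eq_up.
  apply: below; apply: leq_trans (leq_stair lt_ux).
  by rewrite (@stairS u c) // rp addn1.
(* Right of the walk, only the column next to it may exceed [r], and that column
   is not right of [v]: compare the sums of row [u]. *)
have {le_cv lt_cv} lt_cv : c < v by rewrite ltn_neqAle eq_sym lt_cv.
apply: (sum_eq_lt_le_false (rows u) _ lt_uv) => j.
have [lt_jv|lt_vj|/val_inj->] := ltngtP j v; last 1 first.
- by apply: ltnW.
- by rewrite eq_left.
have lt_cj := leq_ltn_trans lt_cv lt_vj.
by apply: le_r; rewrite gtn_eqF // ltnW.
Qed.
End Staircase.

Local Open Scope ring_scope.

(** * Leading monomials and ideals *)

(** No S-polynomials are needed when the leading monomials of the whole ideal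
    can be controlled directly. *)
Lemma groebner_basis_criterion (K : fieldType) (n : nat) (lt : rel 'X_{1..n})
    (G I : {mpoly K[n]} -> Prop) :
  (exists s : seq {mpoly K[n]}, forall g, G g <-> g \in s) ->
  (forall g, G g -> I g) ->
  (forall f m, I f -> initial_monomial lt f m -> exists g mu,
     [/\ G g, initial_monomial lt g mu & (mu <= m)%MM]) ->
  groebner_basis lt G I.
Proof.
move=> finG subGI divG; split=> // f; split.
  move=> [s [Gs ->]]; exists s; split=> // c /Gs[g [mu [Gg lead ->]]].
  by exists g, mu; split=> //; apply: subGI.
move=> [s [Is ->]]; elim: s Is => [|c s IHs] Is.
  by exists [::]; split.
have [t [Gt sum_t]] := IHs (fun c' c's => Is c' (mem_behead (s := c :: s) c's)).
have [h [m [Ih lead c2]]] := Is c (mem_head c s).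
have [g [mu [Gg lead_g le]]] := divG h m Ih lead.
exists ((c.1 * 'X_[m - mu], 'X_[mu]) :: t); split=> [c'|].
  by rewrite inE => /predU1P[->|/Gt//]; exists g, mu.
by rewrite !big_cons sum_t /= c2 -mulrA -mpolyXD submK.
Qed.

Lemma ideal_gen_kernel (R S : comNzRingType) (phi : {rmorphism R -> S})
    (G : R -> Prop) :
  (forall g, G g -> phi g = 0) -> forall f, ideal_gen G f -> phi f = 0.
Proof.
move=> G0 f [s [Gs ->]]; rewrite rmorph_sum big_seq big1 // => c /Gs/G0 c0.
by rewrite rmorphM c0 mulr0.
Qed.

Lemma ideal_gen_sub (R : comNzRingType) (G : R -> Prop) g : G g -> ideal_gen G g.
Proof.
move=> Gg; exists [:: (1, g)]; split=> [c|]; first by rewrite inE => /eqP->.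
by rewrite big_seq1 mul1r.
Qed.

Lemma ideal_gen0 (R : comNzRingType) (G : R -> Prop) : ideal_gen G 0.
Proof. by exists [::]; split; rewrite ?big_nil. Qed.

(** * Supports and dominant monomials under substitution *)

Section Support.
Variables (K : fieldType) (n N : nat).
Implicit Types (p q : {mpoly K[N]}) (mu nu : 'X_{1..N}) (m : 'X_{1..n}).

(** A relation stable under addition that relates each variable to the monomials
    of its image relates each monomial to those of its image: this is how degree
    equalities and inequalities are read off after a substitution. *)
Lemma mmap1_msupp (P : 'X_{1..N} -> 'X_{1..n} -> Prop)
    (v : 'I_n -> {mpoly K[N]}) :
  P 0%MM 0%MM ->
  (forall nu nu' m m', P nu m -> P nu' m' -> P (nu + nu')%MM (m + m')%MM) ->
  (forall i nu, nu \in msupp (v i) -> P nu U_(i)%MM) ->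
  forall m nu, nu \in msupp (mmap1 v m) -> P nu m.
Proof.
move=> P0 PD Pv m.
pose Q (p : {mpoly K[N]}) m := forall nu, nu \in msupp p -> P nu m.
have Q1 : Q 1 0%MM by move=> nu; rewrite msupp1 inE => /eqP->.
have QM p q m1 m2 : Q p m1 -> Q q m2 -> Q (p * q) (m1 + m2)%MM.
  move=> Qp Qq nu /msuppM_le /allpairsP[[nu1 nu2] [/= /Qp P1 /Qq P2 ->]].
  exact: PD.
suff: Q (mmap1 v m) (\sum_i U_(i) *+ m i)%MM by rewrite -multinomUE_id.
rewrite /mmap1; apply: (big_ind2 Q) => [//|p p' q q'|i _]; first exact: QM.
elim: (m i) => [|k IHk]; first by rewrite expr0 mulm0n.
by rewrite exprS mulmS; apply: QM => // nu /Pv.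
Qed.

Variable w : 'X_{1..N} -> nat.
Hypothesis wD : forall mu nu, w (mu + nu)%MM = (w mu + w nu)%N.

(** For an additive weight, the heaviest parts of polynomials multiply.  When
    that part is a single term it cannot cancel in a product, which gives a
    nonzero coefficient without expanding anything. *)
Definition dominant p mu :=
  mu \in msupp p /\ forall nu, nu \in msupp p -> nu != mu -> (w nu < w mu)%N.

Lemma dominant1 : dominant 1 0%MM.
Proof. by split=> [|nu]; rewrite msupp1 inE // => ->. Qed.

Lemma dominantM p q mu nu :
  dominant p mu -> dominant q nu -> dominant (p * q) (mu + nu)%MM.
Proof.
move=> [p_mu p_lt] [q_nu q_lt].
have wle p' mu' a : dominant p' mu' -> a \in msupp p' -> (w a <= w mu')%N.
  by case=> _ lt /lt; case: eqVneq => [-> //|_ /(_ isT)/ltnW].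
have aux a b : a \in msupp p -> b \in msupp q -> (a, b) != (mu, nu) ->
    (w (a + b)%MM < w (mu + nu)%MM)%N.
  move=> pa qb; rewrite xpair_eqE negb_and !wD.
  have [-> /=|/(p_lt _ pa) lt _] := eqVneq a mu.
    by move/(q_lt _ qb); rewrite ltn_add2l.
  by rewrite -addSn leq_add // (wle _ _ _ (conj q_nu q_lt)).
split=> [|k]; last first.
  move=> /msuppM_le /allpairsP[[a b] [/= pa qb ->]] ne.
  by apply: aux => //; apply: contraNneq ne => -[-> ->].
rewrite mcoeff_msupp mpolyME raddf_sum /= (bigD1_seq (mu, nu)) /=; first last.
- by rewrite allpairs_uniq ?msupp_uniq // => -[? ?] [].
- by apply/allpairsP; exists (mu, nu).
rewrite big_seq_cond big1 ?addr0 => [|[a b] /andP[/allpairsP[[a' b'] [/= pa qb [-> ->]]] ne]].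
  by rewrite mcoeffZ mcoeffX eqxx mulr1 mulf_neq0 -?mcoeff_msupp.
rewrite mcoeffZ mcoeffX; case: eqP => [E|]; last by rewrite mulr0.
by have := aux _ _ pa qb ne; rewrite E ltnn.
Qed.

Lemma dominant_mmap1 (v : 'I_n -> {mpoly K[N]}) (mu : 'I_n -> 'X_{1..N}) m :
  (forall i, (0 < m i)%N -> dominant (v i) (mu i)) ->
  dominant (mmap1 v m) (\sum_i mu i *+ m i)%MM.
Proof.
move=> dom; rewrite /mmap1.
apply: (big_ind2 dominant) => [|p p' q q'|i _].
- exact: dominant1.
- exact: dominantM.
have := dom i; case: (m i) => [_|k /(_ isT)].
  by rewrite expr0 mulm0n; exact: dominant1.
elim: k => [|k IHk] di; first by rewrite expr1 mulm1n.
by rewrite exprS mulmS; apply: dominantM => //; apply: IHk.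
Qed.

(** If the image of [f] vanishes, a monomial occurring in the image of the
    leading monomial has to be cancelled by the image of a smaller one. *)
Lemma mmap_kernel_witness (v : 'I_n -> {mpoly K[N]}) (lt : rel 'X_{1..n})
    (f : {mpoly K[n]}) (m : 'X_{1..n}) nu :
  mmap (@mpolyC N K) v f = 0 -> initial_monomial lt f m ->
  nu \in msupp (mmap1 v m) ->
  exists2 m', lt m' m & nu \in msupp (mmap1 v m').
Proof.
move=> /(congr1 (mcoeff nu)); rewrite mcoeff0 /mmap raddf_sum /=.
move=> + [fm lt_m] nu_m; rewrite (bigD1_seq m) ?msupp_uniq //= => sum0.
have [/hasP[m' fm' /andP[ne nu_m']]|/hasPn none] :=
  boolP (has (fun m' => (m' != m) && (nu \in msupp (mmap1 v m'))) (msupp f)).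
  by exists m' => //; apply: lt_m.
move: sum0; rewrite big_seq_cond big1 ?addr0 => [|m' /andP[fm' ne]].
  by move/eqP; rewrite mcoeffCM mulf_eq0 !mcoeff_eq0 fm nu_m.
rewrite mcoeffCM (@memN_msupp_eq0 _ _ (mmap1 v m')) ?mulr0 //.
by have := none _ fm'; rewrite ne.
Qed.
End Support.

(** * Monomials in a matrix whose columns are grouped into blocks *)

Lemma mxvec_index_eq (d n : nat) (x x' : 'I_d) (y y' : 'I_n) :
  (mxvec_index x y == mxvec_index x' y') = (x == x') && (y == y').
Proof. by rewrite -xpair_eqE (inj_eq (@cast_ord_inj _ _ _)) (inj_eq enum_rank_inj). Qed.

Lemma sum_mxvec (d n : nat) (F : 'I_(d * n) -> nat) :
  (\sum_i F i = \sum_x \sum_y F (mxvec_index x y))%N.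
Proof.
rewrite pair_bigA (reindex _ (curry_mxvec_bij _ _)).
by apply: eq_bigr => -[].
Qed.

Section Blocks.
Variables (d n l : nat) (blk : 'I_n -> 'I_l).
Hypothesis blk_homo : {homo blk : y y' / (y <= y')%N >-> (y <= y')%N}.
Implicit Types m : 'X_{1..d * n}.

Definition block_sum m (x : 'I_d) (j : 'I_l) : nat :=
  \sum_(y | blk y == j) m (mxvec_index x y).

Lemma block_sumD m m' x j :
  block_sum (m + m')%MM x j = (block_sum m x j + block_sum m' x j)%N.
Proof. by rewrite -big_split; apply: eq_bigr => y _; rewrite mnmDE. Qed.

Lemma sum_block_row m x :
  (\sum_j block_sum m x j = \sum_y m (mxvec_index x y))%N.
Proof. by rewrite [RHS](partition_big blk predT). Qed.

(** The leading monomial of the 2-minor with rows [x < x'] and columns [y < y']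
    is the product of the entries [(x, y)] and [(x', y')]. *)
Definition block_standard m := forall (x x' : 'I_d) (y y' : 'I_n),
  (x < x')%N -> (y < y')%N -> blk y = blk y' ->
  (0 < m (mxvec_index x y))%N -> m (mxvec_index x' y') = 0%N.

(** A block-standard monomial fills the cells of a block row by row, each time
    with the rightmost columns still available.  At the first difference [(u, y)]
    it has a factor in [(u, y)], so nothing below row [u] in the columns to the
    right of [y] in the same block: there it has spent the whole column degree
    by row [u], and [m'] cannot have more in row [u]. *)
Lemma block_sum_lex m m' :
  block_standard m ->
  (forall y, \sum_x m' (mxvec_index x y) = \sum_x m (mxvec_index x y))%N ->
  lex_lt m' m ->
  exists (u : 'I_d) (v : 'I_l),
    [/\ (block_sum m' u v < block_sum m u v)%N,
        forall (x : 'I_d) (j : 'I_l), (x < u)%N -> block_sum m' x j = block_sum m x j &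
        forall j : 'I_l, (j < v)%N -> block_sum m' u j = block_sum m u j].
Proof.
move=> std cols /existsP[u /existsP[y /andP[lt_uy /forallP before]]].
have eqv x i : var_gt x i u y -> m' (mxvec_index x i) = m (mxvec_index x i).
  by move=> gt; have /forallP/(_ i)/implyP/(_ gt)/eqP := before x.
have up (x : 'I_d) i : (x < u)%N -> m' (mxvec_index x i) = m (mxvec_index x i).
  by move=> lt; apply: eqv; rewrite /var_gt lt.
have left (i : 'I_n) : (i < y)%N -> m' (mxvec_index u i) = m (mxvec_index u i).
  by move=> lt; apply: eqv; rewrite /var_gt eqxx lt orbT.
exists u, (blk y); split=> [|x j lt|j lt]; first last.
- apply: eq_bigr => i /eqP ij; apply: left; rewrite ltnNge.
  by apply: contraL lt => /blk_homo; rewrite ij -leqNgt.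
- by apply: eq_bigr => i _; apply: up.
rewrite /block_sum (bigD1 y) // [X in (_ < X)%N](bigD1 y) //= -addSn leq_add //.
apply: leq_sum => i /andP[/eqP iy ne]; rewrite leqNgt; apply/negP => lt_i.
have [lt_iy|lt_yi|/val_inj E] := ltngtP i y.
- by rewrite left ?ltnn in lt_i.
- apply: (sum_eq_lt_le_false (F := fun x => m (mxvec_index x i))
            (G := fun x => m' (mxvec_index x i)) _ _ lt_i) => [|x]; first exact/esym.
  have [lt_xu|lt_ux|/val_inj->] := ltngtP x u; first by rewrite up.
    by rewrite (std u x y i) //; apply: leq_ltn_trans lt_uy.
  exact: ltnW.
by rewrite E eqxx in ne.
Qed.
End Blocks.

(** * The parametrization *)

(** The all-ones vector lies in the kernel of [L].  The equality [a = l] is a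
    hypothesis because [a] is the cardinal of a set of rows. *)
Lemma det_mul_kernel (R : comNzRingType) (a l : nat)
    (L : 'M[R]_(a, l)) (Q : 'M[R]_(l, a)) :
  a = l -> (0 < l)%N -> (forall x, \sum_j L x j = 0) -> \det (L *m Q) = 0.
Proof.
move=> al l_gt0 rows0; subst a; rewrite det_mulmx.
suff -> : \det L = 0 by rewrite mul0r.
have L1 : L *m (const_mx 1 : 'cV_l) = 0.
  apply/colP=> x; rewrite !mxE -[RHS](rows0 x).
  by apply: eq_bigr => j _; rewrite mxE mulr1.
have := congr1 (mulmx (\adj L)) L1; rewrite mulmx0 mulmxA mul_adj_mx mul_scalar_mx.
by move/colP/(_ (Ordinal l_gt0)); rewrite !mxE mulr1.
Qed.

Lemma det2_rank1 (R : comNzRingType) (a : nat) (c r : 'I_a -> R) :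
  a = 2%N -> \det (\matrix_(i, j) (c i * r j)) = 0.
Proof.
move=> a2; subst a; rewrite (expand_det_row _ ord0) !big_ord_recl big_ord0.
rewrite /cofactor !det_mx11 !mxE /= !expr0 !expr1.
rewrite addr0 mul1r mulN1r mulrN.
have -> : lift ord0 ord0 = 1 :> 'I_2 by apply: val_inj.
have -> : lift 1 0 = 0 :> 'I_2 by apply: val_inj.
by rewrite mulrACA [c 0 * r 1 * _]mulrACA [r 1 * _]mulrC subrr.
Qed.

Section Param.
Variables (K : fieldType) (d n l : nat) (blk : 'I_n -> 'I_l).
(* [theta] selects the columns whose scalar is not set to zero.  In row [x] the
   entry in column [e x] is eliminated; a value [e x] out of range means that
   the row is free, which is why [e] takes natural numbers. *)
Variables (theta : pred 'I_n) (e : 'I_d -> nat).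

(** Polynomial variables are ordinals, so the parameters b_y and a_(x,j) of the
    parametrization are numbered by enumerating a finite type. *)
Definition param_var : finType := ('I_n + 'I_d * 'I_l)%type.
Notation N := #|param_var|.
Definition scal_var (y : 'I_n) : 'I_N := enum_rank (inl y : param_var).
Definition entry_var x j : 'I_N := enum_rank (inr (x, j) : param_var).

Definition row_form x (j : 'I_l) : {mpoly K[N]} :=
  if j == e x :> nat then - \sum_(i : 'I_l | i != e x :> nat) 'X_(entry_var x i)
  else 'X_(entry_var x j).

Definition param_mx : 'M[{mpoly K[N]}]_(d, n) :=
  \matrix_(x, y) if theta y then 'X_(scal_var y) * row_form x (blk y) else 0.

Definition param : {mpoly K[d * n]} -> {mpoly K[N]} :=
  mmap (@mpolyC N K) (fun i => mxvec param_mx 0 i).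

HB.instance Definition _ := GRing.RMorphism.on param.

Lemma param_generic x y : param (generic_mx K d n x y) = param_mx x y.
Proof. by rewrite mxE /param mmapX mmap1U mxvecE. Qed.

Lemma param_minor (A : {set 'I_d}) (B : {set 'I_n}) (eqAB : #|A| = #|B|) :
  param (minor (generic_mx K d n) eqAB) = minor param_mx eqAB.
Proof.
rewrite /minor -det_map_mx map_mxsub.
suff -> : map_mx param (generic_mx K d n) = param_mx by [].
by apply/matrixP=> x y; rewrite mxE param_generic.
Qed.

Lemma param_block_minor (A : {set 'I_d}) (B : {set 'I_n}) (eqAB : #|A| = #|B|) j :
  #|A| = 2%N -> {in B, forall y, blk y = j} ->
  param (minor (generic_mx K d n) eqAB) = 0.
Proof.
move=> A2 Bj; rewrite param_minor /minor -[RHS](det2_rank1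
  (fun i => row_form (enum_val i) j)
  (fun i => let y := enum_val (cast_ord eqAB i) in
     if theta y then 'X_(scal_var y) else 0) A2).
congr (\det _); apply/matrixP=> x y; rewrite !mxE (Bj _ (enum_valP _)) /=.
by case: ifP; rewrite ?mulr0 // mulrC.
Qed.

Lemma row_form_sum x : (e x < l)%N -> \sum_j row_form x j = 0.
Proof.
move=> lt_e; rewrite (bigD1 (Ordinal lt_e)) //= {1}/row_form eqxx.
apply/eqP; rewrite addrC subr_eq0; apply/eqP; apply: eq_big => [//|j ne].
by rewrite /row_form (negbTE (ne : _ != e x :> nat)).
Qed.

(** The submatrix is the product of the forms [L] of its rows with a matrix that
    places the scalar of the column [y] in row [blk y]; this covers columns in
    distinct blocks and columns sharing a block alike. *)
Lemma param_maximal_minor (A : {set 'I_d}) (B : {set 'I_n}) (eqAB : #|A| = #|B|) :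
  #|A| = l -> (0 < l)%N -> (forall x, (e x < l)%N) ->
  param (minor (generic_mx K d n) eqAB) = 0.
Proof.
move=> Al l0 lt_e; rewrite param_minor /minor.
rewrite -[RHS](@det_mul_kernel _ _ _ (\matrix_(i, j) row_form (enum_val i) j)
 (\matrix_(j, i) let y := enum_val (cast_ord eqAB i) in
    if (j == blk y) && theta y then 'X_(scal_var y) else 0) Al l0); last first.
  move=> i; rewrite -[RHS](row_form_sum (lt_e (enum_val i))).
  by apply: eq_bigr => j _; rewrite mxE.
congr (\det _); apply/matrixP=> x i; rewrite !mxE.
rewrite (bigD1 (blk (enum_val (cast_ord eqAB i)))) //=.
rewrite !mxE /= eqxx big1 => [|j ne]; last by rewrite !mxE /= (negbTE ne) mulr0.
by rewrite addr0; case: ifP; rewrite ?mulr0 // mulrC.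
Qed.

(** The block whose parameter represents the cell [(x, y)] in [param_lead]: an
    eliminated entry is represented by the parameter next to it on the right,
    where the staircase walk goes.  That parameter exists whenever the monomial
    under study has a factor in an eliminated entry of row [x]; the default of
    [insubd] is taken in no such row. *)
Definition lead_block x y : 'I_l :=
  if blk y == e x :> nat then insubd (blk y) (e x).+1 else blk y.

Definition lead_mx : 'M['X_{1..N}]_(d, n) :=
  \matrix_(x, y) (U_(scal_var y) + U_(entry_var x (lead_block x y)))%MM.

Definition param_lead (m : 'X_{1..d * n}) : 'X_{1..N} :=
  (\sum_i mxvec lead_mx ord0 i *+ m i)%MM.

(** Chosen so that, in the sum replacing the eliminated entry of row [x], the
    parameter in column [e x + 1] outweighs all others. *)
Definition param_weight (nu : 'X_{1..N}) : nat :=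
  \sum_(p : 'I_d * 'I_l | p.2 == (e p.1).+1 :> nat) nu (entry_var p.1 p.2).

Lemma param_weightD nu nu' :
  param_weight (nu + nu')%MM = (param_weight nu + param_weight nu')%N.
Proof. by rewrite -big_split; apply: eq_bigr => p _; rewrite mnmDE. Qed.

Lemma scal_var_eq y y' : (scal_var y == scal_var y') = (y == y').
Proof. by rewrite (inj_eq enum_rank_inj). Qed.

Lemma entry_var_eq x j x' j' :
  (entry_var x j == entry_var x' j') = (x == x') && (j == j').
Proof. by rewrite (inj_eq enum_rank_inj) -xpair_eqE. Qed.

Lemma scal_entry_var y x j : (scal_var y == entry_var x j) = false.
Proof. by rewrite (inj_eq enum_rank_inj). Qed.

Lemma entry_scal_var y x j : (entry_var x j == scal_var y) = false.
Proof. by rewrite (inj_eq enum_rank_inj). Qed.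

Lemma msupp_row_form x j nu : nu \in msupp (row_form x j) ->
  exists2 i, nu = U_(entry_var x i)%MM
    & if j == e x :> nat then i != e x :> nat else i == j.
Proof.
rewrite /row_form; case: ifP => [_|_].
  rewrite (perm_mem (msuppN _)) => /msupp_sum_le/flatten_mapP[i].
  rewrite mem_filter => /andP[ne _]; rewrite msuppX inE => /eqP->.
  by exists i.
by rewrite msuppX inE => /eqP->; exists j.
Qed.

Lemma msupp_param_mx x y nu : nu \in msupp (param_mx x y) ->
  exists2 i, nu = (U_(scal_var y) + U_(entry_var x i))%MM
    & if blk y == e x :> nat then i != e x :> nat else i == blk y.
Proof.
rewrite mxE; case: ifP => [_|_]; last by rewrite msupp0.
move=> /msuppM_le/allpairsP[[a b] [/= ]].
by rewrite msuppX inE => /eqP-> /msupp_row_form[i -> ?] ->; exists i.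
Qed.

Lemma param_weight_edge y x i :
  param_weight (U_(scal_var y) + U_(entry_var x i))%MM = (i == (e x).+1 :> nat).
Proof.
rewrite param_weightD /param_weight big1 => [|p _]; last by rewrite mnm1E scal_entry_var.
rewrite add0n; case: eqVneq => [E|ne].
  rewrite (bigD1 (x, i)) /= ?E // mnm1E eqxx big1 // => -[x' i'] /andP[_].
  by rewrite mnm1E entry_var_eq -xpair_eqE eq_sym => /negbTE->.
rewrite big1 // => -[x' i'] /= i'E; rewrite mnm1E entry_var_eq.
by case: eqP => // E; case: eqP => // E'; rewrite E E' i'E in ne.
Qed.

Lemma dominant_param_mx x y : theta y -> (blk y = e x :> nat -> (e x).+1 < l)%N ->
  dominant param_weight (param_mx x y) (lead_mx x y).
Proof.
move=> ty small; split=> [|nu]; last first.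
  move=> /msupp_param_mx[i -> cond]; rewrite [lead_mx _ _]mxE !param_weight_edge.
  rewrite /lead_block; case: (eqVneq (blk y : nat) (e x)) cond => [E ne|_ /eqP->];
    last by rewrite eqxx.
  have lt := small E; rewrite val_insubd lt eqxx => neU.
  case: eqP => // E'; case/eqP: neU; congr (_ + U_(entry_var _ _))%MM.
  by apply: val_inj; rewrite val_insubd lt.
rewrite !mxE ty /lead_block /row_form; case: eqP => [/small lt|_]; last first.
  by rewrite -mpolyXD msuppX inE.
set j := insubd _ _; have jE : j = (e x).+1 :> nat by rewrite val_insubd lt.
rewrite mcoeff_msupp mulrC mcoeffMX mcoeffN oppr_eq0 raddf_sum /=.
rewrite (bigD1 j) ?jE ?gtn_eqF //= mcoeffX eqxx big1 ?addr0 ?oner_eq0 // => i /andP[_ ne].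
by rewrite mcoeffXU entry_var_eq eqxx (negbTE ne).
Qed.

(** What a monomial [nu] in the image of [m] remembers: the column and row
    degrees exactly, and an upper bound for [m] in each row and block that is not
    eliminated. *)
Definition param_inv (nu : 'X_{1..N}) (m : 'X_{1..d * n}) :=
  [/\ forall y, nu (scal_var y) = (\sum_x m (mxvec_index x y))%N,
      forall x, (\sum_j nu (entry_var x j) = \sum_y m (mxvec_index x y))%N &
      forall x (j : 'I_l),
        j != e x :> nat -> (block_sum blk m x j <= nu (entry_var x j))%N].

Lemma param_msupp nu m :
  nu \in msupp (param 'X_[m]) -> param_inv nu m.
Proof.
rewrite /param mmapX; apply: mmap1_msupp => [|{}nu nu' {}m m'|i {}nu].
- split=> [y|x|x j _]; rewrite ?mnm0E.
  + by rewrite big1 // => x _; rewrite mnm0E.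
  + by rewrite !big1 // => *; rewrite mnm0E.
  by rewrite /block_sum big1 // => *; rewrite mnm0E.
- move=> [c r b] [c' r' b']; split=> [y|x|x j ne].
  + by rewrite mnmDE c c' -big_split; apply: eq_bigr => x _; rewrite mnmDE.
  + transitivity (\sum_j nu (entry_var x j) + \sum_j nu' (entry_var x j))%N.
      by rewrite -big_split; apply: eq_bigr => j _; rewrite mnmDE.
    by rewrite r r' -big_split; apply: eq_bigr => y _; rewrite mnmDE.
  by rewrite block_sumD mnmDE leq_add ?b ?b'.
case/mxvec_indexP: i => x y; rewrite mxvecE => /msupp_param_mx[i -> cond].
split=> [y'|x'|x' j ne].
- rewrite mnmDE !mnm1E scal_var_eq entry_scal_var addn0 (bigD1 x) //= mnm1E mxvec_index_eq eqxx.
  by rewrite big1 ?addn0 // => x' ne; rewrite mnm1E mxvec_index_eq eq_sym (negbTE ne).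
- have [<-|ne] := eqVneq x x'; last first.
    rewrite big1 => [|j _].
      by rewrite big1 // => j _; rewrite mnm1E mxvec_index_eq (negbTE ne).
    by rewrite mnmDE !mnm1E scal_entry_var entry_var_eq (negbTE ne).
  rewrite (bigD1 i) // [RHS](bigD1 y) //= mnmDE !mnm1E scal_entry_var entry_var_eq mxvec_index_eq !eqxx.
  rewrite big1 => [|j ne].
    by rewrite big1 // => j ne; rewrite mnm1E mxvec_index_eq eqxx eq_sym (negbTE ne).
  by rewrite mnmDE !mnm1E scal_entry_var entry_var_eq eqxx eq_sym (negbTE ne).
rewrite mnmDE !mnm1E scal_entry_var entry_var_eq add0n.
have [xx'|nex] := eqVneq x x'; last first.
  by rewrite /block_sum big1 // => j' _; rewrite mnm1E mxvec_index_eq (negbTE nex).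
rewrite -{x'}xx' in ne *; rewrite /block_sum; have [E|neb] := eqVneq (blk y) j; last first.
  rewrite big1 // => j' /eqP; rewrite mnm1E mxvec_index_eq.
  by case: (eqVneq y j') => [<- E|]; rewrite ?andbF //; case/eqP: neb.
rewrite (bigD1 y) ?E //= big1 => [|j' /andP[_ nej]]; last first.
  by rewrite mnm1E mxvec_index_eq eqxx eq_sym (negbTE nej).
by rewrite mnm1E eqxx; move: cond; rewrite E (negbTE ne) => /eqP->; rewrite eqxx.
Qed.

(** Only the parameter next to the eliminated entry receives a contribution from
    another block. *)
Lemma param_lead_entry_le (m : 'X_{1..d * n}) x (j : 'I_l) :
  (forall y, (0 < m (mxvec_index x y))%N -> blk y = e x :> nat ->
     ((e x).+1 < l)%N) ->
  j != e x :> nat -> j != (e x).+1 :> nat ->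
  (param_lead m (entry_var x j) <= block_sum blk m x j)%N.
Proof.
move=> small ne ne1; rewrite /param_lead mnm_sumE sum_mxvec.
rewrite (bigD1 x) //= [X in (_ + X <= _)%N]big1 ?addn0 => [|x' nex]; last first.
  rewrite big1 // => y _; rewrite mulmnE mxvecE mxE mnmDE !mnm1E scal_entry_var entry_var_eq.
  by rewrite (negbTE nex).
rewrite /block_sum [leqRHS]big_mkcond /=; apply: leq_sum => y _.
rewrite mulmnE mxvecE mxE mnmDE !mnm1E scal_entry_var entry_var_eq eqxx /=.
case: (posnP (m (mxvec_index x y))) => [->|/small]; first by rewrite muln0.
rewrite /lead_block; case: (eqVneq (blk y : nat) (e x)) => [E /(_ E) lt|_ _]; last first.
  by case: eqP; rewrite ?mul1n.
suff -> : (insubd (blk y) (e x).+1 == j) = false by [].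
by apply/negbTE; apply: contra ne1 => /eqP<-; rewrite val_insubd lt.
Qed.

(** The image of a smaller monomial [m'] must cancel the dominant term
    [param_lead m] in the image of [m].  Then [m] and [m'] have the same column
    degrees, and the comparison of monomials turns into one of the matrices of
    block sums. *)
Lemma param_kernel_lex (f : {mpoly K[d * n]}) m :
  {homo blk : y y' / (y <= y')%N >-> (y <= y')%N} ->
  param f = 0 -> initial_monomial (@lex_lt d n) f m -> block_standard blk m ->
  (forall x y, (0 < m (mxvec_index x y))%N -> theta y) ->
  (forall x y, (0 < m (mxvec_index x y))%N -> blk y = e x :> nat ->
     ((e x).+1 < l)%N) ->
  let r := block_sum blk m in
  exists (r' : 'I_d -> 'I_l -> nat) (u : 'I_d) (v : 'I_l),
    [/\ (forall x, \sum_j r' x j = \sum_j r x j)%N,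
        (forall j, \sum_x r' x j = \sum_x r x j)%N,
        (forall (x : 'I_d) (j : 'I_l),
           j != e x :> nat -> j != (e x).+1 :> nat -> (r' x j <= r x j)%N) &
        [/\ (r' u v < r u v)%N,
            (forall (x : 'I_d) (j : 'I_l), (x < u)%N -> r' x j = r x j) &
            (forall j : 'I_l, (j < v)%N -> r' u j = r u j)]].
Proof.
move=> blk_homo f0 fm std pos small r.
have dom : dominant param_weight (param 'X_[m]) (param_lead m).
  rewrite /param mmapX; apply: dominant_mmap1 param_weightD _ _ _ _ => i.
  case/mxvec_indexP: i => x y mi; rewrite !mxvecE.
  by apply: dominant_param_mx; [exact: pos mi|exact: small].
have [c0 r0 _] := param_msupp dom.1.
have lead_in := dom.1; rewrite /param mmapX in lead_in.
have [m' lt_m'm] := mmap_kernel_witness f0 fm lead_in.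
rewrite -(mmapX _ (@mpolyC N K)) => /param_msupp[c1 r1 b1].
have cols y : (\sum_x m' (mxvec_index x y) = \sum_x m (mxvec_index x y))%N by rewrite -c0 c1.
have [u [v lexuv]] := block_sum_lex blk_homo std cols lt_m'm.
exists (block_sum blk m'), u, v; split=> // [x|j|x j ne ne1].
- by rewrite !sum_block_row -r0 r1.
- by rewrite /r /block_sum exchange_big [RHS]exchange_big; apply: eq_bigr => y _.
by apply: leq_trans (b1 _ _ ne) _; apply: param_lead_entry_le => // y; apply: small.
Qed.
End Param.

(** * Leading monomials of minors *)

Lemma lex_lt_irr (d e : nat) (m : 'X_{1..d * e}) : ~~ lex_lt m m.
Proof. by apply/existsP => -[x /existsP[y]]; rewrite ltnn. Qed.

Definition increasing a b (f : 'I_a -> 'I_b) :=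
  forall i j : 'I_a, (i < j)%N -> (f i < f j)%N.

Lemma increasing_ltn a b (f : 'I_a -> 'I_b) : increasing f ->
  forall i j, (f i < f j)%N -> (i < j)%N.
Proof.
move=> incf i j lt; rewrite ltnNge leq_eqVlt; apply/orP=> -[/eqP/val_inj E|/incf lt'].
  by rewrite E ltnn in lt.
by have := ltn_trans lt lt'; rewrite ltnn.
Qed.

Lemma increasing_inj a b (f : 'I_a -> 'I_b) : increasing f -> injective f.
Proof.
move=> incf i j E; apply: val_inj.
by have [/incf|/incf|//] := ltngtP i j; rewrite E ltnn.
Qed.

Section DiagonalTerm.
Variables (K : fieldType) (d n a : nat) (f : 'I_a -> 'I_d) (g : 'I_a -> 'I_n).
Hypotheses (incf : increasing f) (incg : increasing g).

(** The monomial of the term of the Leibniz expansion belonging to [s]. *)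
Definition graph_mnm (s : 'I_a -> 'I_a) : 'X_{1..d * n} :=
  (\sum_i U_(mxvec_index (f i) (g (s i))))%MM.

Lemma graph_mnmE s x y :
  graph_mnm s (mxvec_index x y) = (\sum_i ((f i == x) && (g (s i) == y)))%N.
Proof.
by rewrite mnm_sumE; apply: eq_bigr => i _; rewrite mnm1E mxvec_index_eq.
Qed.

(** Take the first row [i] moved by [s].  The values below [i] are fixed, so
    [s i > i]: the main diagonal has a factor at [(i, i)], while [s] has none
    there and agrees with the diagonal at all larger variables. *)
Lemma graph_mnm_lt (s : {perm 'I_a}) :
  s != 1%g -> lex_lt (graph_mnm s) (graph_mnm id).
Proof.
move=> s1; have [i0 mv0] : exists i0, s i0 != i0.
  apply/existsP; rewrite -negb_forall; apply: contra s1 => /forallP fix_s.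
  by apply/eqP/permP=> i; rewrite perm1; apply/eqP.
case: (arg_minnP (fun i : 'I_a => val i) (P := fun i => s i != i) mv0) => i mv min_i.
have fix_s (i' : 'I_a) : (i' < i)%N -> s i' = i'.
  by move=> lt; apply/eqP; apply: contraTT lt => /min_i; rewrite -leqNgt.
have lt_is : (i < s i)%N.
  have [//|lt|/val_inj E] := ltngtP i (s i); last by rewrite -E eqxx in mv.
  by have /perm_inj E := fix_s _ lt; rewrite E eqxx in mv.
apply/existsP; exists (f i); apply/existsP; exists (g i); apply/andP; split.
  rewrite !graph_mnmE big1 => [|i' _].
    by rewrite (bigD1 i) //= !eqxx.
  rewrite (inj_eq (increasing_inj incf)) (inj_eq (increasing_inj incg)).
  by case: (eqVneq i' i) => //= ->; rewrite (negbTE mv).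
apply/forallP=> u; apply/forallP=> v; apply/implyP=> gt; apply/eqP.
rewrite !graph_mnmE; apply: eq_bigr => i' _; case: (eqVneq (f i') u) => //= E.
case/orP: gt => [|/andP[/eqP Eu lt]].
  by rewrite -E => /(increasing_ltn incf)/fix_s ->.
have -> : i' = i by apply: (increasing_inj incf); rewrite E Eu.
congr nat_of_bool; transitivity false; last first.
  by apply/esym/negbTE; apply: contraTneq lt => ->; rewrite ltnn.
apply/negbTE; apply: contraTneq lt => <-; rewrite -leqNgt ltnW //.
exact: incg.
Qed.

(** No other term of the Leibniz expansion has the monomial of the identity, so
    that monomial survives, with coefficient one. *)
Lemma det_initial_monomial :
  initial_monomial (@lex_lt d n)
    (\det (\matrix_(i, j) generic_mx K d n (f i) (g j))) (graph_mnm id).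
Proof.
have prodE (s : {perm 'I_a}) :
    \prod_i (\matrix_(i, j) generic_mx K d n (f i) (g j)) i (s i) =
    'X_[graph_mnm s].
  by rewrite -mprodXE; apply: eq_bigr => i _; rewrite !mxE.
split.
  rewrite mcoeff_msupp /determinant raddf_sum /= (bigD1 1%g) //= [X in _ + X]big1 ?addr0 => [|s s1].
    rewrite prodE odd_perm1 expr0 mul1r mcoeffX.
    have -> : graph_mnm (1%g : {perm 'I_a}) = graph_mnm id.
      by apply: eq_bigr => i _; rewrite perm1.
    by rewrite eqxx oner_neq0.
  rewrite prodE mulr_sign; have /negbTE ne : graph_mnm s != graph_mnm id.
    by apply: contraTneq (graph_mnm_lt s1) => ->; exact: lex_lt_irr.
  by case: (odd_perm s); rewrite ?mcoeffN mcoeffX ne ?oppr0.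
move=> m /msupp_sum_le/flatten_mapP[s _].
rewrite prodE mulr_sign => m_s; have {m_s} -> : m = graph_mnm s.
  by apply/eqP; move: m_s; case: (odd_perm s); rewrite ?(perm_mem (msuppN _)) msuppX inE.
move=> ne; apply: graph_mnm_lt; apply: contraNneq ne => ->.
by apply/eqP; apply: eq_bigr => i _; rewrite perm1.
Qed.

Lemma graph_mnm_le (m : 'X_{1..d * n}) :
  (forall i, (0 < m (mxvec_index (f i) (g i)))%N) -> (graph_mnm id <= m)%MM.
Proof.
move=> pos; apply/mnm_lepP=> i; case/mxvec_indexP: i => x y; rewrite graph_mnmE.
case: (pickP (fun i => (f i == x) && (g i == y))) => [i /andP[/eqP fx /eqP gy]|none].
  rewrite (bigD1 i) //= fx gy !eqxx big1 => [|i' ne]; first by rewrite -fx -gy.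
  by rewrite -fx (inj_eq (increasing_inj incf)) (negbTE ne).
by rewrite big1 // => i _; rewrite none.
Qed.
End DiagonalTerm.

Lemma enum_imset_increasing a b (f : 'I_a -> 'I_b) : increasing f ->
  enum [set f i | i : 'I_a] = [seq f i | i <- enum 'I_a].
Proof.
move=> incf; pose lt (i j : 'I_b) := (i < j)%N.
have lt_tr : transitive lt by move=> y x z; apply: ltn_trans.
apply: (@irr_sorted_eq _ lt lt_tr) => [i|||i]; first exact: ltnn.
- rewrite {1}/enum_mem; apply: sorted_filter => //.
  have : sorted ltn (map val (enum 'I_b)) by rewrite val_enum_ord iota_ltn_sorted.
  by rewrite sorted_map enumT.
- have : sorted ltn (map val (enum 'I_a)) by rewrite val_enum_ord iota_ltn_sorted.
  rewrite !sorted_map; apply: sub_sorted => i j; exact: incf.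
rewrite mem_enum; apply/imsetP/mapP => [[j _ ->]|[j _ ->]]; exists j => //.
by rewrite mem_enum.
Qed.

Lemma enum_val_imset_increasing a b (f : 'I_a -> 'I_b)
    (i : 'I_#|[set f i | i : 'I_a]|) (j : 'I_a) :
  increasing f -> i = j :> nat -> enum_val i = f j.
Proof.
move=> incf E; rewrite (enum_val_nth (f j)) enum_imset_increasing //.
by rewrite (nth_map j) ?size_enum_ord ?E // nth_ord_enum.
Qed.

(** Minors are indexed by sets, diagonals by increasing sequences; the enumeration
    of the image of an increasing sequence is that sequence. *)
Lemma minor_increasing (R : comNzRingType) d n a (M : 'M[R]_(d, n))
    (f : 'I_a -> 'I_d) (g : 'I_a -> 'I_n) : increasing f -> increasing g ->
  exists eqAB : #|[set f i | i : 'I_a]| = #|[set g i | i : 'I_a]|,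
    minor M eqAB = \det (\matrix_(i, j) M (f i) (g j)).
Proof.
move=> incf incg.
have cA : #|[set f i | i : 'I_a]| = a by rewrite card_imset ?card_ord //; exact: increasing_inj.
have cB : #|[set g i | i : 'I_a]| = a by rewrite card_imset ?card_ord //; exact: increasing_inj.
exists (etrans cA (esym cB)); rewrite /minor.
have cast b (h : b = a) (F : 'I_b -> 'I_d) (G : 'I_b -> 'I_n) :
    (forall i, F i = f (cast_ord h i)) -> (forall i, G i = g (cast_ord h i)) ->
    \det (mxsub F G M) = \det (\matrix_(i, j) M (f i) (g j)).
  subst b => Ff Gg; congr (\det _); apply/matrixP=> i j.
  by rewrite !mxE Ff Gg !cast_ord_id.
by apply: (cast _ cA) => i; apply: enum_val_imset_increasing.
Qed.

Lemma minor_lead_divides (K : fieldType) d n a (Bs : pred {set 'I_n})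
    (f : 'I_a -> 'I_d) (g : 'I_a -> 'I_n) (m : 'X_{1..d * n}) :
  increasing f -> increasing g -> Bs [set g i | i : 'I_a] ->
  (forall i, (0 < m (mxvec_index (f i) (g i)))%N) ->
  exists h mu, [/\ @generic_minors K d n a Bs h,
                   initial_monomial (@lex_lt d n) h mu & (mu <= m)%MM].
Proof.
move=> incf incg Bsg pos.
have [eqAB minE] := minor_increasing (generic_mx K d n) incf incg.
exists (minor (generic_mx K d n) eqAB), (graph_mnm f g id); split.
- exists [set f i | i : 'I_a], [set g i | i : 'I_a], eqAB; split=> //.
  by rewrite card_imset ?card_ord //; exact: increasing_inj.
- by rewrite minE; apply: det_initial_monomial.
exact: graph_mnm_le.
Qed.

Definition pair_fun (T : Type) (x x' : T) (i : 'I_2) := if i == ord0 then x else x'.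

Lemma pair_fun_increasing b (x x' : 'I_b) : (x < x')%N -> increasing (pair_fun x x').
Proof. by move=> lt [[|[|?]] ?] [[|[|?]] ?]. Qed.

Lemma block_standard_or_minor (K : fieldType) d n l (blk : 'I_n -> 'I_l)
    (Bs : pred {set 'I_n}) (m : 'X_{1..d * n}) :
  (forall B : {set 'I_n}, #|B| = 2%N -> {in B &, forall y y', blk y = blk y'} -> Bs B) ->
  block_standard blk m \/
  exists h mu, [/\ @generic_minors K d n 2 Bs h,
                   initial_monomial (@lex_lt d n) h mu & (mu <= m)%MM].
Proof.
move=> BsP.
case: (boolP [exists x : 'I_d, exists x' : 'I_d, exists y : 'I_n, exists y' : 'I_n,
  [&& x < x', y < y', blk y == blk y', 0 < m (mxvec_index x y) & 0 < m (mxvec_index x' y')]%N]).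
  move=> /existsP[x /existsP[x' /existsP[y /existsP[y']]]].
  case/and5P=> ltx lty /eqP blkE pos pos'; right.
  have incg := pair_fun_increasing lty.
  apply: (minor_lead_divides K (pair_fun_increasing ltx) incg) => [|i]; last first.
    by rewrite /pair_fun; case: ifP.
  apply: BsP; first by rewrite card_imset ?card_ord //; exact: increasing_inj.
  have eqy i : blk (pair_fun y y' i) = blk y by rewrite /pair_fun; case: ifP.
  by move=> _ _ /imsetP[i _ ->] /imsetP[j _ ->]; rewrite !eqy.
move=> none; left=> x x' y y' ltx lty blkE pos; apply/eqP; rewrite -leqn0 leqNgt.
apply: contra none => pos'.
do 2![apply/existsP; eexists]; do 2![apply/existsP; eexists].
by apply/and5P; split; [exact: ltx|exact: lty|exact/eqP|exact: pos|exact: pos'].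
Qed.

Lemma generic_minors_finite (K : fieldType) (d n r : nat) (Bs : pred {set 'I_n}) :
  exists s : seq {mpoly K[d * n]}, forall f, generic_minors r Bs f <-> f \in s.
Proof.
pose F (p : {set 'I_d} * {set 'I_n}) := if #|p.1| =P #|p.2| is ReflectT eqAB then
    if (#|p.1| == r) && Bs p.2 then Some (minor (generic_mx K d n) eqAB) else None
  else None.
exists (pmap F (enum {: {set 'I_d} * {set 'I_n}})) => f; rewrite mem_pmap; split.
  move=> [A [B [eqAB [Ar BsB ->]]]]; apply/mapP; exists (A, B); first by rewrite mem_enum.
  rewrite /F /=; case: eqP => [eqAB'|//].
  have -> : (#|A| == r) && Bs B by rewrite Ar eqxx.
  congr (Some (minor _ _)); apply: eq_irrelevance.
case/mapP=> -[A B] _; rewrite /F /=; case: eqP => // eqAB.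
by case: ifP => // /andP[/eqP Ar BsB] [->]; exists A, B, eqAB.
Qed.

(** * The two Groebner bases *)

Section Final.
Variables (K : fieldType) (k l d : nat).
Hypothesis k_gt0 : (0 < k)%N.

Lemma block_of_subproof (y : 'I_(k * l)) : (y %/ k < l)%N.
Proof. by rewrite ltn_divLR // [X in (_ < X)%N]mulnC. Qed.

Definition block_of y : 'I_l := Ordinal (block_of_subproof y).

Lemma block_of_homo : {homo block_of : y y' / (y <= y')%N >-> (y <= y')%N}.
Proof. by move=> y y' /= le; apply: leq_div2r. Qed.

Lemma mem_colY (j : 'I_l) (y : 'I_(k * l)) : (y \in colY k j) = (block_of y == j).
Proof.
apply/imsetP/eqP => [[i _ ->]|E].
  by apply: val_inj; rewrite /= divnMDl // divn_small ?addn0.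
have lt : (y %% k < k)%N by rewrite ltn_mod.
exists (Ordinal lt) => //; apply: val_inj; rewrite /= -E /=; exact: divn_eq.
Qed.

Lemma rowY_card (i : 'I_k) : #|rowY l i| = l.
Proof.
rewrite card_imset ?card_ord // => j j' /(congr1 val) /= /eqP.
by rewrite eqn_add2r eqn_pmul2r // => /eqP/val_inj.
Qed.

Notation blk := block_of.
Notation lex := (@lex_lt d (k * l)).

Lemma sub_colY (B : {set 'I_(k * l)}) (j : 'I_l) :
  (B \subset colY k j) -> {in B, forall y, blk y = j}.
Proof. by move=> /subsetP sub y /sub; rewrite mem_colY => /eqP. Qed.

Lemma same_block_sub (B : {set 'I_(k * l)}) : #|B| = 2%N ->
  {in B &, forall y y', blk y = blk y'} -> [exists j : 'I_l, B \subset colY k j].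
Proof.
move=> B2 same; have /card_gt0P[y By] : (0 < #|B|)%N by rewrite B2.
apply/existsP; exists (blk y); apply/subsetP=> y' By'.
by rewrite mem_colY (same y' y).
Qed.

Lemma column_minors_param theta e f :
  ideal_gen (@column_minors K d k l) f -> param blk theta e f = 0.
Proof.
apply: ideal_gen_kernel => g [A [B [eqAB [A2 /existsP[j /sub_colY Bj] ->]]]].
exact: param_block_minor A2 Bj.
Qed.

(** Here no row is constrained.  If [m] is block-standard and avoids the columns
    in [S], the block sums of the smaller monomial that must cancel it are bounded
    by those of [m]; as the row sums are equal, none can be strictly smaller. *)
Lemma gens_I_S_groebner (S : {set 'I_(k * l)}) :
  groebner_basis lex (@gens_I_S K d k l S) (@I_S K d k l S).
Proof.
apply: groebner_basis_criterion => [|g Gg|f m ISf lead]; last 1 first.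
- have [std|[h [mu [minor_h lead_h le]]]] :=
    block_standard_or_minor K (d := d) m same_block_sub; last first.
    by exists h, mu; split=> //; right.
  case: (boolP [exists x : 'I_d, exists y : 'I_(k * l),
                  (y \in S) && (0 < m (mxvec_index x y))%N]).
    move=> /existsP[x /existsP[y /andP[yS pos]]].
    exists (generic_mx K d (k * l) x y), U_(mxvec_index x y)%MM; split.
    + by left; exists x, y.
    + by rewrite mxE; split=> [|m']; rewrite msuppX inE // => /eqP->; rewrite eqxx.
    by rewrite lep1mP -lt0n.
  move=> none; exfalso.
  have notS x y : (0 < m (mxvec_index x y))%N -> y \notin S.
    move=> pos; apply: contra none => yS; apply/existsP; exists x; apply/existsP; exists y.
    by rewrite yS.
  (* Column [l] does not exist: no entry is eliminated. *)
  pose e (x : 'I_d) := l.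
  have f0 : param blk (fun y => y \notin S) e f = 0.
    apply: ideal_gen_kernel ISf => g [[x [y [yS ->]]]|Gg]; last first.
      exact/column_minors_param/ideal_gen_sub.
    by rewrite [LHS](param_generic K blk _ e x y) mxE yS.
  have [||r' [u [v [rows _ le [lt _ _]]]]] :=
    param_kernel_lex block_of_homo f0 lead std.
  + exact: notS.
  + by move=> x y _ E; have := ltn_ord (blk y); rewrite E ltnn.
  apply: (sum_eq_lt_le_false (rows u) _ lt) => j; apply: le.
    by rewrite ltn_eqF.
  by rewrite ltn_eqF // ltnS ltnW.
- have [s Es] := generic_minors_finite K d 2 (fun B => [exists j : 'I_l, B \subset colY k j]).
  exists ([seq generic_mx K d (k * l) x y | x <- enum 'I_d, y <- enum S] ++ s) => g.
  rewrite mem_cat; split=> [[[x [y [yS ->]]]|/Es->]|]; rewrite ?orbT //.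
    by rewrite allpairs_f ?mem_enum.
  case/orP=> [/allpairsP[[x y] [/= _ yS ->]]|/Es]; last by right.
  by left; exists x, y; rewrite mem_enum in yS.
exact: ideal_gen_sub.
Qed.

Hypothesis l_gt1 : (1 < l)%N.

Lemma param_I_0 e f : (forall x, e x < l)%N ->
  @I_0 K d k l f -> param blk predT e f = 0.
Proof.
move=> lt_e [g [h [Ig Ih ->]]]; rewrite raddfD /= (column_minors_param _ _ Ig) add0r.
apply: ideal_gen_kernel Ih => {}h [A [B [eqAB [Al _ ->]]]].
by apply: param_maximal_minor => //; apply: ltnW.
Qed.

(** A row [R_i] has [l] elements, so it is the column set of a 2-minor only when
    [l] is two, and then that minor is among the [l]-minors. *)
Lemma G_I_0_sub g : @G_I_0 K d k l g -> @I_0 K d k l g.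
Proof.
case=> [[A [B [eqAB [A2 BD ->]]]]|[A [B [eqAB [Al _ ->]]]]]; last first.
  exists 0, (minor (generic_mx K d (k * l)) eqAB); split; last by rewrite add0r.
    exact: ideal_gen0.
  by apply: ideal_gen_sub; exists A, B, eqAB.
case/setUP: BD => [/bigcupP[j _]|/imsetP[i _ Bi]].
  rewrite inE => /andP[sub _]; exists (minor (generic_mx K d (k * l)) eqAB), 0.
  split; [|exact: ideal_gen0|by rewrite addr0].
  by apply: ideal_gen_sub; exists A, B, eqAB; split=> //; apply/existsP; exists j.
have l2 : #|A| = l by rewrite eqAB Bi rowY_card.
exists 0, (minor (generic_mx K d (k * l)) eqAB); split; last by rewrite add0r.
  exact: ideal_gen0.
by apply: ideal_gen_sub; exists A, B, eqAB.
Qed.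

(** Either the staircase walk in the block sums of [m] reaches column [l], and
    its steps exhibit the main diagonal of an [l]-minor dividing [m], or it
    supplies the columns to eliminate in the parametrization. *)
Lemma G_I_0_groebner :
  groebner_basis lex (@G_I_0 K d k l) (@I_0 K d k l).
Proof.
apply: groebner_basis_criterion => [|g|f m If lead]; last 1 first.
- have sameD (B : {set 'I_(k * l)}) : #|B| = 2%N ->
    {in B &, forall y y', blk y = blk y'} -> B \in Delta k l.
    move=> B2 /(same_block_sub B2)/existsP[j sub]; apply/setUP; left.
    by apply/bigcupP; exists j => //; rewrite inE sub B2.
  have [std|[h [mu [minor_h lead_h le]]]] :=
    block_standard_or_minor K (d := d) m sameD; last first.
    by exists h, mu; split=> //; left.
  pose r := block_sum blk m; have [long|short] := leqP l (stair r d).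
    have chain (j : 'I_l) : exists p : 'I_d * 'I_(k * l),
        [/\ stair r p.1 = j, blk p.2 = j & (0 < m (mxvec_index p.1 p.2))%N].
      have [x [i [ex /val_inj-> rp]]] := stair_onto (leq_trans (ltn_ord j) long).
      have /existsP[y /andP[/eqP yj pos]] :
          [exists y, (blk y == j) && (0 < m (mxvec_index x y))%N].
        apply: contraLR rp; rewrite negb_exists => /forallP none.
        rewrite -leqNgt leqn0 /r /block_sum big1 // => y yj.
        by have := none y; rewrite yj /= -leqNgt leqn0 => /eqP.
      by exists (x, y).
    have [p /all_and3[px py ppos]] := fin_all_exists chain.
    have incf : increasing (fun j => (p j).1).
      by move=> i j lt; apply: (@stair_lt _ _ r); rewrite !px.
    have incg : increasing (fun j => (p j).2).
      move=> i j lt; rewrite ltnNge; apply: contraL lt => /block_of_homo.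
      by rewrite !py -leqNgt.
    have one : [forall j : 'I_l, #|[set (p i).2 | i : 'I_l] :&: colY k j| <= 1]%N.
      apply/forallP=> j; apply/card_le1_eqP=> _ _
        /setIP[/imsetP[i _ ->] +] /setIP[/imsetP[i' _ ->]].
      by rewrite !mem_colY !py => /eqP-> /eqP->.
    have [h [mu [minor_h lead_h le]]] := minor_lead_divides K
      (Bs := fun B => [forall j : 'I_l, #|B :&: colY k j| <= 1]%N) incf incg one ppos.
    by exists h, mu; split=> //; right.
  exfalso.
  have lt_e (x : 'I_d) : (stair r x < l)%N.
    by apply: leq_ltn_trans short; apply: leq_stair; apply: ltnW.
  have [||r' [u [v [rows cols le [lt up left]]]]] :=
    param_kernel_lex block_of_homo (param_I_0 lt_e If) lead std => //.
    move=> x y pos E; apply: leq_ltn_trans short.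
    have rp : (0 < r x (blk y))%N.
      by apply: leq_trans pos _; rewrite /r /block_sum (bigD1 y) //= leq_addr.
    have <- : stair r x.+1 = (stair r x).+1 by rewrite (stairS (esym E)) rp addn1.
    exact: leq_stair.
  exact: (stair_lex short rows cols le up left lt).
- have [s Es] := generic_minors_finite K d 2 (fun B => B \in Delta k l).
  have [t Et] := generic_minors_finite K d l
    (fun B => [forall j : 'I_l, #|B :&: colY k j| <= 1]%N).
  exists (s ++ t) => g; rewrite mem_cat; split=> [[/Es->|/Et->]|/orP[/Es|/Et]].
  + by [].
  + by rewrite orbT.
  + by left.
  by right.
exact: G_I_0_sub.
Qed.
End Final.

Theorem theorem2p4 (K : fieldType) (k l d : nat)
    (hk : (2 <= k)%N) (hkl : (k <= l)%N) (hld : (l <= d)%N) :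
  groebner_basis (@lex_lt d (k * l)) (@G_I_0 K d k l) (@I_0 K d k l)
  /\ (forall S : {set 'I_(k * l)}, calL S ->
        groebner_basis (@lex_lt d (k * l)) (@gens_I_S K d k l S)
                       (@I_S K d k l S)).
Proof.
have k_gt0 : (0 < k)%N by apply: ltnW.
split=> [|S _]; last exact: gens_I_S_groebner.
exact: G_I_0_groebner (leq_trans hk hkl).
Qed.
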